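(* The problem of maximizing the provider's profit $P_c(d)$ over single lead-time quotes $d\in[0,\infty]$ has an optimal solution $(d^{P_c}_{n_{P_c}},n_{P_c})$: letting $n_{P_c}$ be a maximizer of $H_c(n_0)=\sup\{P_c(d): n_0(d)=n_0\}$ over $n_0\in\{\underline n,\ldots,\overline n\}$, the quote $d^{P_c}_{n_{P_c}}$ has balking threshold $n_{P_c}$, and the maximum provider profit is $$P_c^*=\sup_d P_c(d)=\lambda\sum_{n=0}^{n_{P_c}-1}q(n;n_{P_c})\,G_n\big(d^{P_c}_{n_{P_c}}\big).$$
   Context: Parameters: $\lambda,\mu>0$ (arrival and service rates), $\rho=\lambda/\mu$; service value $R$, entrance fee $p$, waiting cost rate $c>0$, compensation rate $l$, risk-aversion coefficient $r>0$, with $0\le p\le R$ and $0\le l<c$. For each integer $n\ge 0$, $X_n\sim Gamma(n+1,\mu)$ has density $\mu^{n+1}x^ne^{-\mu x}/n!$ on $(0,\infty)$. A lead-time quote is $d\in[0,\infty]$; $d=\infty$ means no compensation, with $(x-\infty)^+=0$. Expected utility of a joining customer who finds $n$ customers and is quoted $d$: $$B_n(d)=E\left[\frac{1-e^{-r(R-p-cX_n+l(X_n-d)^+)}}{r}\right]\in[-\infty,\infty).$$ The customer joins iff $B_n(d)\ge 0$. Let $L_n(d)=E(X_n-d)^+$, and let $G_n(d)=p-lL_n(d)$ if $B_n(d)\ge0$, $G_n(d)=0$ if $B_n(d)<0$. Put $\underline n=\inf\{n\ge0:\lim_{d\to\infty}B_n(d)<0\}$, $\overline n=\inf\{n\ge0:B_n(0)<0\}$,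 $q(n;n_0)=\rho^n/\sum_{k=0}^{n_0}\rho^k$ for $0\le n\le n_0$, and $\tilde d^P_n=\sup\{d\ge0:B_n(d)\ge0\}$ with $\sup\varnothing=-1$. The same quote $d$ is offered in all states; its balking threshold is $n_0(d)=\min\{n\ge0:B_n(d)<0\}$ and its profit per unit time is $P_c(d)=\lambda\sum_{n=0}^{n_0(d)-1}q(n;n_0(d))G_n(d)$. Let $d^{P_c}_{\underline n}=\infty$ and $d^{P_c}_{n_0}=\tilde d^P_{n_0-1}$ for $n_0\in\{\underline n+1,\ldots,\overline n\}$. *)

(* Defs.v *)
From HB Require Import structures.
From mathcomp Require Import all_boot all_order all_algebra.
From mathcomp Require Import all_classical all_reals all_analysis.

Set Implicit Arguments.
Unset Strict Implicit.
Unset Printing Implicit Defensive.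

Import Order.TTheory GRing.Theory Num.Theory.
Import numFieldNormedType.Exports.

Local Open Scope classical_set_scope.
Local Open Scope ring_scope.

Record params (R : realType) := Params {
  arrival : R;        (* lambda *)
  service : R;        (* mu *)
  value : R;          (* service value *)
  fee : R;            (* p *)
  waiting : R;        (* c *)
  compensation : R;   (* l *)
  risk : R            (* r *)
}.

Section gamma.
Context {R : realType}.

Definition gamma_pdf (n : nat) (mu x : R) : R :=
  if 0 < x then mu ^+ n.+1 * x ^+ n * expR (- (mu * x)) / n`!%:R else 0.

Definition is_gamma d (T : measurableType d) (P : probability T R)
    (X : {RV P >-> R}) (n : nat) (mu : R) : Prop :=
  forall A : set R, measurable A ->
    P (X @^-1` A) = (\int[lebesgue_measure]_(x in A) (gamma_pdf n mu x)%:E)%E.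

End gamma.

(* Equal to the minimum of [A] when [A] is nonempty, and [0] otherwise.  The
   sets of states it is applied to below are nonempty for gamma-distributed
   sojourn times when [service], [risk] are positive and
   [compensation < waiting]: B_n(d) < 0 for [n] large, uniformly in [d]. *)
Definition nat_min (A : set nat) : nat :=
  xget 0%N [set n | A n /\ forall k, A k -> (n <= k)%N].

Section model.
Context {R : realType} {disp : measure_display} {T : measurableType disp}
  {P : probability T R}.
Implicit Types (m : params R) (X : nat -> {RV P >-> R}) (n : nat) (d : \bar R).

(* (x - d)^+; a quote is an extended real [d] with [0 <= d], and the value at
   [-oo] is irrelevant. *)
Definition overrun (x : R) d : R :=
  if d is d'%:E then Num.max (x - d') 0 else 0.

Definition utility m (y : R) : R := (1 - expR (- (risk m * y))) / risk m.

(* B_n(d) *)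
Definition joining_utility m X n d : \bar R :=
  'E_P[fun w => utility m (value m - fee m - waiting m * X n w
                           + compensation m * overrun (X n w) d)].

(* L_n(d) *)
Definition lateness X n d : \bar R := 'E_P[fun w => overrun (X n w) d].

(* G_n(d) *)
Definition gain m X n d : \bar R :=
  (if 0 <= joining_utility m X n d
   then (fee m)%:E - (compensation m)%:E * lateness X n d else 0)%E.

(* \underline n and \overline n *)
Definition n_lower m X : nat :=
  nat_min [set n | (lim (joining_utility m X n x%:E @[x --> +oo%R]) < 0)%E].

Definition n_upper m X : nat :=
  nat_min [set n | (joining_utility m X n 0 < 0)%E].

(* q(n; n0) *)
Definition state_prob m n (n0 : nat) : R :=
  let rho := arrival m / service m in rho ^+ n / \sum_(0 <= k < n0.+1) rho ^+ k.

(* n_0(d) *)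
Definition threshold m X d : nat :=
  nat_min [set n | (joining_utility m X n d < 0)%E].

(* P_c(d) *)
Definition profit m X d : \bar R :=
  ((arrival m)%:E *
   \sum_(0 <= n < threshold m X d)
     (state_prob m n (threshold m X d))%:E * gain m X n d)%E.

(* \tilde d^P_n, with sup of the empty set equal to -1 *)
Definition max_joining_quote m X n : \bar R :=
  let D := [set d | (0 <= d)%E /\ (0 <= joining_utility m X n d)%E] in
  if pselect (D = set0) then (-1)%:E else ereal_sup D.

(* d^{P_c}_{n0}, for n0 between \underline n and \overline n *)
Definition candidate_quote m X (n0 : nat) : \bar R :=
  if n0 == n_lower m X then +oo%E else max_joining_quote m X n0.-1.

(* H_c(n0) *)
Definition best_profit m X (n0 : nat) : \bar R :=
  ereal_sup [set profit m X d | d in [set d | (0 <= d)%E /\ threshold m X d = n0]].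

Definition is_best_threshold m X (n0 : nat) : Prop :=
  (n_lower m X <= n0 <= n_upper m X)%N /\
  forall k, (n_lower m X <= k <= n_upper m X)%N ->
    (best_profit m X k <= best_profit m X n0)%E.

End model.

(* Main.v *)
Require Import Defs.
From HB Require Import structures.
From mathcomp Require Import all_boot all_order all_algebra.
From mathcomp Require Import all_classical all_reals all_analysis.
From mathcomp Require Import measurable_realfun ring lra.
Set Implicit Arguments.
Unset Strict Implicit.
Unset Printing Implicit Defensive.

Import Order.TTheory GRing.Theory Num.Theory.
Import numFieldNormedType.Exports.
Local Open Scope classical_set_scope.
Local Open Scope ring_scope.

(** Everything is read off from the expected exponential cost
    [Z n d = E exp (r (c X_n - l (X_n - d)^+ - (R - p)))], for which
    [B_n(d) = (1 - Z n d) / r]; so a customer joins iff [Z n d <= 1]. As a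
    function of [d], [Z] is nondecreasing and
    [Z n d' <= exp (r l (d' - d)) * Z n d] for finite [d <= d']
    ([expected_disutility_Lipschitz]): on the finite quotes it is either
    infinite everywhere, or finite everywhere and continuous. It tends to
    [Z n +oo] at infinity by monotone convergence ([lim_joining_utility]), so
    that [n_lower] is the threshold of the quote [+oo], just as [n_upper] is
    that of the quote [0].

    As a function of [n], [Z n d] grows at least by a fixed [delta > 0] at each
    step, uniformly in [d] ([expected_disutilityS]). The reason is the identity
    [x f_n(x) = ((n + 1) / mu) f_{n+1}(x)] between consecutive gamma densities.
    Since every [f_n] has total mass 1, it gives [E X_n = (n + 1) / mu], and it
    turns [E phi(X_{n+1}) - E phi(X_n)] into a covariance of [phi(X_n)] and
    [X_n], which is nonnegative for nondecreasing [phi]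
    ([nondecreasing_expectation_gamma]). The exponential cost increases with
    slope at least some [kappa > 0] because [l < c]; taking away [kappa * x],
    whose expectation grows by [kappa / mu], leaves a nondecreasing function,
    whence [delta = kappa / mu]. In particular thresholds exist, and
    [n < threshold d] iff [Z n d <= 1] ([ltn_threshold]).

    Among the quotes with a given threshold [n0] the largest one is the most
    profitable, since the stationary distribution is the same and the
    compensation paid does not increase with the quote ([le_profit]). For
    [n0 = n_lower] the largest quote is [+oo]. For [n_lower < n0 <= n_upper],
    let [s] be the largest quote accepted in state [n0 - 1]. By continuity
    [Z (n0 - 1) s = 1], hence [Z n0 s >= 1 + delta > 1] and [s] has threshold
    exactly [n0] ([max_joining_quoteP], [candidate_quoteP]). So the best profit
    at threshold [n0] is that of the candidate quote, and maximizing over all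
    quotes amounts to maximizing over the finitely many values of [n0]. *)

(** * Expectations of functions of gamma variables *)

Section density.
Context {R : realType} {disp : measure_display} {T : measurableType disp}
  {P : probability T R}.
Implicit Types (X : {RV P >-> R}) (f g h : R -> R) (n : nat) (mu : R).

Local Open Scope ereal_scope.

Lemma probability_integral_cst (r : R) : \int[P]_w r%:E = r%:E.
Proof.
rewrite [LHS](integral_cst P measurableT r%:E).
by rewrite [X in _ * X]probability_setT mule1.
Qed.

(** The density of the law of [X] agrees almost everywhere with its
    Radon-Nikodym derivative, for which the change of variables is known. *)
Lemma ge0_expectation_density X h f :
  (forall x, 0 <= h x)%R -> measurable_fun setT h ->
  (forall A, measurable A ->
    P (X @^-1` A) = \int[lebesgue_measure]_(x in A) (h x)%:E) ->
  (forall x, 0 <= f x)%R -> measurable_fun setT f ->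
  \int[P]_w (f (X w))%:E = \int[lebesgue_measure]_x (f x * h x)%:E.
Proof.
move=> h0 mh Xh f0 mf.
(* The Lebesgue measure lives on an alias of R generated by intervals; X is
   repackaged with this codomain so that its law can be compared with it. *)
have mX : measurable_fun setT (X : T -> measurableTypeR R).
  by move=> mT A mA; exact: (measurable_funPT X mT A mA).
pose Y : {RV P >-> measurableTypeR R} :=
  HB.pack (X : T -> measurableTypeR R) (isMeasurableFun.Build _ _ _ _ _ mX).
have XL : distribution P Y `<< (@lebesgue_measure R).
  apply/null_content_dominatesP => A mA A0.
  rewrite /distribution /pushforward Xh//.
  apply: null_set_integral => //; apply/measurable_EFinP.
  exact: measurable_funTS.
rewrite -(ge0_integral_distribution Y (f := EFin \o f)); last 2 first.
- exact/measurable_EFinP.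
- by move=> x; rewrite lee_fin.
rewrite -(Radon_Nikodym_SigmaFinite.change_of_variables
  (nu := distribution P Y) XL)//; last first.
  exact/measurable_EFinP.
have RNi := Radon_Nikodym_SigmaFinite.f_integrable (nu := distribution P Y) XL.
apply: ge0_ae_eq_integral => //=.
- apply: emeasurable_funM; first exact/measurable_EFinP.
  exact: measurable_int RNi.
- by apply/measurable_EFinP; exact: measurable_funM.
- move=> x _; rewrite mule_ge0 ?lee_fin//.
  exact: Radon_Nikodym_SigmaFinite.f_ge0.
- by move=> x _; rewrite lee_fin mulr_ge0.
under [X in ae_eq _ _ _ X]eq_fun do rewrite EFinM.
apply: ae_eqe_mul2l; apply: integral_ae_eq => //.
- exact/measurable_EFinP.
- move=> A _ mA; rewrite -Radon_Nikodym_SigmaFinite.f_integral//.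
  exact: Xh.
Qed.

Lemma gamma_pdf_ge0 n mu x : (0 <= mu)%R -> (0 <= gamma_pdf n mu x)%R.
Proof.
move=> mu0; rewrite /gamma_pdf; case: ifPn => // x0.
by rewrite divr_ge0// !mulr_ge0 ?exprn_ge0 ?expR_ge0 ?ler0n// ltW.
Qed.

Lemma measurable_gamma_pdf n mu : measurable_fun setT (@gamma_pdf R n mu).
Proof.
apply: measurable_fun_if => //.
  by apply: measurable_fun_ltr.
apply: measurable_funTS; apply: measurable_funM => //.
apply: measurable_funM.
  by apply: measurable_funM => //; exact: measurable_funX.
by apply: measurableT_comp => //; apply: measurableT_comp.
Qed.

(** The factor is [`|x|] rather than [x] so that it multiplies nonnegative
    functions into nonnegative functions on the whole line; the two agree where
    the density does not vanish. *)
Lemma gamma_pdfS n mu x : (0 < mu)%R ->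
  (`|x| * gamma_pdf n mu x = n.+1%:R / mu * gamma_pdf n.+1 mu x)%R.
Proof.
move=> mu0; rewrite /gamma_pdf; case: ifPn => [x0|_]; last by rewrite !mulr0.
rewrite (gtr0_norm x0) factS natrM !exprS invfM.
field.
by rewrite nat1r !pnatr_eq0 -lt0n fact_gt0/= gt_eqF.
Qed.

Section gamma.
Context (X : nat -> {RV P >-> R}) (mu : R) (mu0 : (0 < mu)%R)
  (Xg : forall n, is_gamma (X n) n mu).

Lemma ge0_expectation_gamma n f :
  (forall x, 0 <= f x)%R -> measurable_fun setT f ->
  \int[P]_w (f (X n w))%:E =
  \int[lebesgue_measure]_x (f x * gamma_pdf n mu x)%:E.
Proof.
move=> f0 mf; apply: ge0_expectation_density => //.
- by move=> x; rewrite gamma_pdf_ge0// ltW.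
- exact: measurable_gamma_pdf.
- exact: Xg.
Qed.

Lemma le_expectation_gamma n f g :
  (forall x, 0 <= f x)%R -> (forall x, 0 <= g x)%R ->
  measurable_fun setT f -> measurable_fun setT g ->
  (forall x, 0 < x -> f x <= g x)%R ->
  \int[P]_w (f (X n w))%:E <= \int[P]_w (g (X n w))%:E.
Proof.
move=> f0 g0 mf mg fg; rewrite !ge0_expectation_gamma//.
apply: ge0_le_integral => //=.
- by move=> x _; rewrite lee_fin mulr_ge0// gamma_pdf_ge0// ltW.
- apply/measurable_EFinP; apply: measurable_funM => //.
  exact: measurable_gamma_pdf.
- apply/measurable_EFinP; apply: measurable_funM => //.
  exact: measurable_gamma_pdf.
- move=> x _; rewrite lee_fin; have [x0|x0] := ltP 0%R x.
    by rewrite ler_wpM2r ?fg// gamma_pdf_ge0// ltW.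
  by rewrite /gamma_pdf ltNge x0/= !mulr0.
Qed.

Lemma eq_expectation_gamma n f g :
  (forall x, 0 <= f x)%R -> (forall x, 0 <= g x)%R ->
  measurable_fun setT f -> measurable_fun setT g ->
  (forall x, 0 < x -> f x = g x)%R ->
  \int[P]_w (f (X n w))%:E = \int[P]_w (g (X n w))%:E.
Proof.
move=> f0 g0 mf mg fg; apply/eqP; rewrite eq_le.
by rewrite !le_expectation_gamma// => x /fg ->.
Qed.

Lemma expectation_gamma_shift n f :
  (forall x, 0 <= f x)%R -> measurable_fun setT f ->
  \int[P]_w (f (X n w) * `|X n w|)%:E =
  (n.+1%:R / mu)%:E * \int[P]_w (f (X n.+1 w))%:E.
Proof.
move=> f0 mf.
rewrite (@ge0_expectation_gamma n (fun x => f x * `|x|)%R); last 2 first.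
- by move=> x; rewrite mulr_ge0.
- by apply: measurable_funM.
rewrite ge0_expectation_gamma// -ge0_integralZl_EFin//; last 3 first.
- by move=> x _; rewrite lee_fin mulr_ge0// gamma_pdf_ge0// ltW.
- apply/measurable_EFinP; apply: measurable_funM => //.
  exact: measurable_gamma_pdf.
- by rewrite divr_ge0// ltW.
apply: eq_integral => x _; rewrite -EFinM -mulrA gamma_pdfS//.
by congr (_%:E); rewrite mulrCA.
Qed.

(** The case [f = 1] of the shift: no gamma integral is computed. *)
Lemma expectation_gamma n : \int[P]_w `|X n w|%:E = (n.+1%:R / mu)%:E.
Proof.
have := @expectation_gamma_shift n (cst 1%R) (fun=> ler01) (measurable_cst _).
under eq_integral do rewrite mul1r.
move=> ->; rewrite [X in _ * X](_ : _ = 1) ?mule1//.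
exact: probability_integral_cst.
Qed.

(** With [x0 = E X_n], the shift gives [E (f(X_n) X_n) = x0 E f(X_{n+1})]. It
    remains to integrate [(f x - f x0) (x - x0) >= 0], written with all
    negative terms moved to the other side since [E f(X_n)] may be infinite. *)
Lemma nondecreasing_expectation_gamma n f :
  (forall x, 0 <= f x)%R -> measurable_fun setT f ->
  (forall x y, 0 < x -> x <= y -> f x <= f y)%R ->
  \int[P]_w (f (X n w))%:E <= \int[P]_w (f (X n.+1 w))%:E.
Proof.
move=> f0 mf ndf; set x0 := (n.+1%:R / mu)%R.
have x0_gt0 : (0 < x0)%R by rewrite divr_gt0.
have mfX k : measurable_fun setT (fun w => (f (X k w))%:E).
  by apply/measurable_EFinP; exact: measurableT_comp.
have mX k : measurable_fun setT (fun w => `|X k w|%:E).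
  by apply/measurable_EFinP; exact: measurableT_comp.
have c0 : (0 <= f x0 * x0)%R by rewrite mulr_ge0// ltW.
have mcst k : measurable_fun setT (fun w => (f x0)%:E * `|X k w|%:E).
  by apply: emeasurable_funM.
have lhsE : \int[P]_w (x0 * f (X n w) + f x0 * `|X n w|)%:E =
    x0%:E * \int[P]_w (f (X n w))%:E + (f x0 * x0)%:E.
  under eq_integral do rewrite EFinD !EFinM.
  rewrite ge0_integralD//=; last 3 first.
  - by move=> w _; rewrite -EFinM lee_fin mulr_ge0// ltW.
  - by apply: emeasurable_funM.
  - by move=> w _; rewrite -EFinM lee_fin mulr_ge0.
  rewrite !ge0_integralZl_EFin//; last 2 first.
  - by move=> w _; rewrite lee_fin.
  - by rewrite ltW.
  by rewrite expectation_gamma -EFinM.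
have rhsE : \int[P]_w (f (X n w) * `|X n w| + f x0 * x0)%:E =
    x0%:E * \int[P]_w (f (X n.+1 w))%:E + (f x0 * x0)%:E.
  under eq_integral do rewrite EFinD.
  rewrite ge0_integralD//=; last 2 first.
  - by move=> w _; rewrite lee_fin mulr_ge0.
  - by under eq_fun do rewrite EFinM; exact: emeasurable_funM.
  congr (_ + _); first exact: expectation_gamma_shift.
  exact: probability_integral_cst.
rewrite -(@lee_pmul2l _ x0%:E)// -(@leeD2rE _ (f x0 * x0)%:E)// -lhsE -rhsE.
apply: (@le_expectation_gamma n (fun x => x0 * f x + f x0 * `|x|)%R
  (fun x => f x * `|x| + f x0 * x0)%R) => //.
- by move=> x; rewrite addr_ge0// mulr_ge0// ltW.
- by move=> x; rewrite addr_ge0// mulr_ge0.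
- by apply: measurable_funD; apply: measurable_funM.
- by apply: measurable_funD => //; apply: measurable_funM.
- move=> x x_gt0; rewrite (gtr0_norm x_gt0) -subr_ge0.
  rewrite (_ : (_ - _ = (f x - f x0) * (x - x0))%R); last by ring.
  have [xx0|/ltW x0x] := leP x x0.
    by rewrite mulr_le0// subr_le0// ndf.
  by rewrite mulr_ge0// subr_ge0// ndf.
Qed.
End gamma.
End density.

(** * The exponential cost of waiting *)

Section overrun.
Context {R : realType}.
Implicit Types (x y : R) (d : \bar R).

Lemma overrun_ge0 x d : 0 <= overrun x d.
Proof. by case: d => [d| |]//=; rewrite le_max lexx orbT. Qed.

Lemma overrun0 d : (0 <= d)%E -> overrun 0 d = 0.
Proof.
case: d => [d| |]//=; rewrite lee_fin => d0.
by apply/max_idPr; rewrite sub0r oppr_le0.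
Qed.

Lemma le_overrunB x y d : x <= y -> overrun y d - overrun x d <= y - x.
Proof.
move=> xy; case: d => [d| |] /=; rewrite ?subrr ?subr_ge0//.
by rewrite !maxEle; do 2 case: ifPn => ?; lra.
Qed.

Lemma overrun_antitone x d d' : (0 <= d)%E -> (d <= d')%E ->
  overrun x d' <= overrun x d.
Proof.
case: d => [d| |]//; case: d' => [d'| |]//= _; rewrite ?lee_fin => dd'.
- by rewrite !maxEle; do 2 case: ifPn => ?; lra.
- by rewrite le_max lexx orbT.
Qed.

Lemma le_overrunD x (d d' : R) : d <= d' ->
  overrun x d%:E <= overrun x d'%:E + (d' - d).
Proof. by move=> dd' /=; rewrite !maxEle; do 2 case: ifPn => ?; lra. Qed.

Lemma measurable_overrun d : measurable_fun setT (fun x : R => overrun x d).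
Proof.
case: d => [d| |] /=; [|exact: measurable_cst..].
by apply: measurable_maxr => //; exact: measurable_funB.
Qed.

End overrun.

Section disutility.
Context {R : realType}.
Implicit Types (m : params R) (x y : R) (d : \bar R).

(** [exp (- r y)] for the net monetary gain [y] of a customer whose sojourn time
    is [x], so that [utility m y = (1 - disutility m d x) / r]. *)
Definition disutility m d x : R :=
  expR (risk m * (waiting m * x - compensation m * overrun x d
                  - (value m - fee m))).

Lemma disutility_ge0 m d x : 0 <= disutility m d x.
Proof. exact: expR_ge0. Qed.

Lemma measurable_disutility m d : measurable_fun setT (disutility m d).
Proof.
apply: measurableT_comp => //; apply: measurable_funM => //.
apply: measurable_funB => //; apply: measurable_funB.
  exact: measurable_funM.
by apply: measurable_funM => //; exact: measurable_overrun.
Qed.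

(** The net cost has slope at least [c - l] in [x], and the exponential is at
    least its value [exp (- r (R - p))] at [x = 0]. *)
Definition disutility_slope m : R :=
  risk m * (waiting m - compensation m) * expR (- (risk m * (value m - fee m))).

Context (m : params R) (risk_gt0 : 0 < risk m)
  (compensation_bounds : 0 <= compensation m < waiting m).

Lemma disutility_slope_gt0 : 0 < disutility_slope m.
Proof.
have /andP[_ lc] := compensation_bounds.
by rewrite /disutility_slope !mulr_gt0 ?expR_gt0// subr_gt0.
Qed.

Lemma le_disutility d d' x : (0 <= d)%E -> (d <= d')%E ->
  disutility m d x <= disutility m d' x.
Proof.
have /andP[l0 _] := compensation_bounds.
move=> d0 dd'; rewrite ler_expR ler_pM2l// lerB// lerB// ler_wpM2l//.
exact: overrun_antitone.
Qed.

(** Postponing the quote by [e] costs the customer at most [l * e], whatever the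
    sojourn time. *)
Lemma disutility_Lipschitz (d d' : R) x : d <= d' ->
  disutility m d'%:E x <=
  expR (risk m * compensation m * (d' - d)) * disutility m d%:E x.
Proof.
have /andP[l0 _] := compensation_bounds.
move=> dd'; rewrite -expRD ler_expR -mulrA -mulrDr ler_pM2l//.
have := ler_wpM2l l0 (le_overrunD x dd'); lra.
Qed.

Lemma disutility_increase d x y : (0 <= d)%E -> 0 <= x -> x <= y ->
  disutility_slope m * (y - x) <= disutility m d y - disutility m d x.
Proof.
have /andP[l0 lc] := compensation_bounds.
move=> d0 x0 xy.
pose h z := waiting m * z - compensation m * overrun z d - (value m - fee m).
have hincr z z' : z <= z' ->
    (waiting m - compensation m) * (z' - z) <= h z' - h z.
  by move=> zz'; have := ler_wpM2l l0 (le_overrunB d zz'); rewrite /h; lra.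
have gx : expR (- (risk m * (value m - fee m))) <= disutility m d x.
  rewrite -mulrN ler_expR ler_pM2l//; have := hincr _ _ x0.
  have : 0 <= (waiting m - compensation m) * (x - 0).
    by rewrite mulr_ge0// subr_ge0// ltW.
  by rewrite /h overrun0//; lra.
have -> : disutility m d y = disutility m d x * expR (risk m * (h y - h x)).
  by rewrite -expRD; congr expR; rewrite /h; ring.
rewrite -{2}[disutility m d x]mulr1 -mulrBr /disutility_slope [X in X * _]mulrC.
rewrite -mulrA ler_pM ?expR_ge0//.
  by rewrite !mulr_ge0// ?subr_ge0// ltW.
have := expR_ge1Dx (risk m * (h y - h x)).
have : risk m * ((waiting m - compensation m) * (y - x)) <=
    risk m * (h y - h x) by rewrite ler_pM2l// hincr.
lra.
Qed.

(** Subtracting [disutility_slope m * x] from the cost keeps it nonnegative,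
    so that it stays within the reach of integrals of nonnegative functions. *)
Lemma disutility_ge_linear d x : (0 <= d)%E -> 0 <= x ->
  disutility_slope m * x <= disutility m d x.
Proof.
move=> d0 x0; have := disutility_increase d0 (lexx 0) x0.
by rewrite subr0 => /le_trans; apply; rewrite gerBl disutility_ge0.
Qed.

End disutility.

(** * Expected disutility *)

Section expected_disutility.
Context {R : realType} {disp : measure_display} {T : measurableType disp}
  {P : probability T R}.
Implicit Types (X : nat -> {RV P >-> R}) (m : params R) (n : nat) (d : \bar R).
Local Open Scope ereal_scope.

Definition expected_disutility m X n d : \bar R :=
  \int[P]_w (disutility m d (X n w))%:E.

(** The integral of [f] may be infinite, so the integral is not split linearly;
    instead [a f + g^+ = a + g^-], with [g = a (1 - f)], is integrated. *)
Lemma probability_integral_1B (a : R) (f : T -> R) :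
  (0 < a)%R -> (forall w, 0 <= f w)%R -> measurable_fun setT f ->
  \int[P]_w (a * (1 - f w))%:E = a%:E * (1 - \int[P]_w (f w)%:E).
Proof.
move=> a0 f0 mf; set g := fun w => (a * (1 - f w))%R.
have mg : measurable_fun setT (EFin \o g).
  apply/measurable_EFinP; apply: measurable_funM => //.
  exact: measurable_funB.
have g_le w : (g w <= a)%R by rewrite /g; have := f0 w; nra.
set p := \int[P]_w (EFin \o g)^\+ w.
set q := \int[P]_w (EFin \o g)^\- w.
set I := \int[P]_w (f w)%:E.
have I0 : 0 <= I by apply: integral_ge0 => w _; rewrite lee_fin.
have q0 : 0 <= q by apply: integral_ge0.
have p_fin : p \is a fin_num.
  rewrite ge0_fin_numE; last by apply: integral_ge0.
  apply: (@le_lt_trans _ _ (\int[P]_w a%:E)).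
    apply: ge0_le_integral => //.
    - exact: measurable_funepos.
    - by move=> w _; rewrite funeposE/= ge_max !lee_fin g_le ltW.
  by rewrite probability_integral_cst ltry.
have : a%:E * I + p = a%:E + q.
  rewrite -ge0_integralZl_EFin//; last 3 first.
  - by move=> w _; rewrite lee_fin.
  - exact/measurable_EFinP.
  - exact: ltW.
  rewrite -[X in X + q](probability_integral_cst (P := P)).
  rewrite -!ge0_integralD//.
  all: try by move=> w _; rewrite -?EFinM lee_fin ?mulr_ge0// ltW.
  - apply: eq_integral => w _; rewrite -EFinM funeposE funenegE/=.
    rewrite -!EFin_max -!EFinD; congr EFin.
    by rewrite /g !maxEle; do 2 case: ifPn; lra.
  - exact: measurable_funeneg.
  - by apply: emeasurable_funM => //; exact/measurable_EFinP.
  - exact: measurable_funepos.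
have -> : \int[P]_w (g w)%:E = p - q by rewrite integralE.
move: I0 q0 p_fin; case: I => [i| |]//; case: q => [s| |]//; case: p => [t| |]//.
- by move=> _ _ _ [ait]; rewrite -!EFinD -EFinM; congr EFin; lra.
- by rewrite gt0_muley.
- by move=> _ _ _ _ /=; rewrite !addeNy gt0_muleNy.
Qed.

Section model.
Context (m : params R) (service_gt0 : (0 < service m)%R)
  (risk_gt0 : (0 < risk m)%R)
  (compensation_bounds : (0 <= compensation m < waiting m)%R)
  (X : nat -> {RV P >-> R})
  (X_gamma : forall n, is_gamma (X n) n (service m)).

Local Notation Z n d := (expected_disutility m X n d).

Let measurable_disutilityX n d :
  measurable_fun setT (fun w => (disutility m d (X n w))%:E).
Proof.
by apply/measurable_EFinP; apply: measurableT_comp => //;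
  exact: measurable_disutility.
Qed.

Lemma expected_disutility_ge0 n d : 0 <= Z n d.
Proof.
by apply: integral_ge0 => w _; rewrite lee_fin disutility_ge0.
Qed.

Lemma joining_utilityE n d :
  joining_utility m X n d = (risk m)^-1%:E * (1 - Z n d).
Proof.
rewrite /joining_utility unlock.
rewrite -probability_integral_1B ?invr_gt0//; last 2 first.
- by move=> w; exact: disutility_ge0.
- exact/measurable_EFinP/measurable_disutilityX.
apply: eq_integral => w _ /=; rewrite /utility mulrC -mulrN.
by congr (_ * (1 - expR (_ * _)))%:E; ring.
Qed.

Lemma joining_utility_ge0 n d : (0 <= joining_utility m X n d) = (Z n d <= 1).
Proof.
have rV : (0 < (risk m)^-1)%R by rewrite invr_gt0.
rewrite joining_utilityE; move: (expected_disutility_ge0 n d).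
case: (Z n d) => [z| |]// _.
  by rewrite -EFinD -EFinM !lee_fin pmulr_rge0// subr_ge0.
by rewrite /= addeNy gt0_muleNy.
Qed.

Lemma joining_utility_lt0 n d : (joining_utility m X n d < 0) = (1 < Z n d).
Proof. by rewrite !ltNge joining_utility_ge0. Qed.

Lemma le_expected_disutility n d d' : 0 <= d -> d <= d' -> Z n d <= Z n d'.
Proof.
move=> d0 dd'; apply: ge0_le_integral => //.
- by move=> w _; rewrite lee_fin disutility_ge0.
- by move=> w _; rewrite lee_fin le_disutility.
Qed.

Lemma expected_disutility_Lipschitz n (d d' : R) : (d <= d')%R ->
  Z n d'%:E <= (expR (risk m * compensation m * (d' - d)))%:E * Z n d%:E.
Proof.
move=> dd'; rewrite -ge0_integralZl_EFin// ?expR_ge0//; last first.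
  by move=> w _; rewrite lee_fin disutility_ge0.
apply: ge0_le_integral => //.
- by move=> w _; rewrite lee_fin disutility_ge0.
- by apply: emeasurable_funM.
- by move=> w _; rewrite -EFinM lee_fin disutility_Lipschitz.
Qed.

(** The cost minus its linear part [k x] is nondecreasing, hence its expectation
    does not decrease from [X_n] to [X_{n+1}], while [k E X_n] grows by
    [k / mu]. *)
Lemma expected_disutilityS n d : 0 <= d ->
  Z n d + (disutility_slope m / service m)%:E <= Z n.+1 d.
Proof.
move=> d0; set k := disutility_slope m.
have k0 : (0 < k)%R := disutility_slope_gt0 risk_gt0 compensation_bounds.
pose f (x : R) := (disutility m d `|x| - k * `|x|)%R.
have f0 x : (0 <= f x)%R.
  by rewrite subr_ge0 disutility_ge_linear.
have mf : measurable_fun setT f.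
  apply: measurable_funB; last exact: measurable_funM.
  by apply: (measurableT_comp (f := disutility m d)) => //;
    exact: measurable_disutility.
have ndf x y : (0 < x -> x <= y -> f x <= f y)%R.
  move=> x0 xy; have y0 := lt_le_trans x0 xy.
  rewrite /f !gtr0_norm//.
  have := disutility_increase risk_gt0 compensation_bounds d0 (ltW x0) xy.
  by rewrite -/k; lra.
have ZE j : Z j d = \int[P]_w (f (X j w))%:E + (k * (j.+1%:R / service m))%:E.
  rewrite EFinM -(expectation_gamma service_gt0 X_gamma).
  have mX : measurable_fun setT (fun w => `|X j w|%:E).
    by apply/measurable_EFinP; exact: measurableT_comp.
  rewrite -ge0_integralZl_EFin//; last exact: ltW.
  have mfX : measurable_fun setT (fun w => (f (X j w))%:E).
    by apply/measurable_EFinP; exact: measurableT_comp.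
  have kX0 w : 0 <= k%:E * `|X j w|%:E by rewrite -EFinM lee_fin mulr_ge0// ltW.
  rewrite -ge0_integralD//.
  - rewrite -[RHS](@eq_expectation_gamma _ _ _ _ _ _ service_gt0 X_gamma j
      (disutility m d) (fun x => f x + k * `|x|)%R)//.
    + by move=> x; exact: disutility_ge0.
    + by move=> x; rewrite /f subrK disutility_ge0.
    + exact: measurable_disutility.
    + by apply: measurable_funD => //; exact: measurable_funM.
    + by move=> x x0; rewrite /f subrK gtr0_norm.
  - by move=> w _; rewrite lee_fin.
  - exact: emeasurable_funM.
have Ef := nondecreasing_expectation_gamma service_gt0 X_gamma n f0 mf ndf.
rewrite !ZE -addeA -EFinD; apply: leeD => //; rewrite lee_fin.
by rewrite -(natr1 n.+1) mulrDl mul1r mulrDr.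
Qed.

Lemma expected_disutility_homo n k d : 0 <= d -> (n <= k)%N -> Z n d <= Z k d.
Proof.
move=> d0; elim: k => [|k IHk]; first by rewrite leqn0 => /eqP ->.
rewrite leq_eqVlt => /predU1P[->//|/IHk/le_trans]; apply.
apply: le_trans (expected_disutilityS _ d0); rewrite leeDl// lee_fin.
by rewrite divr_ge0// ltW// disutility_slope_gt0.
Qed.

Lemma expected_disutility_unbounded d : 0 <= d -> exists n, 1 < Z n d.
Proof.
move=> d0; set k := (disutility_slope m / service m)%R.
have k0 : (0 < k)%R by rewrite divr_gt0// disutility_slope_gt0.
have kZ n : (k * n%:R)%:E <= Z n d.
  elim: n => [|n IHn]; first by rewrite mulr0 expected_disutility_ge0.
  apply: le_trans (expected_disutilityS _ d0).
  by rewrite -natr1 mulrDr mulr1 EFinD leeD2r.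
exists (Num.bound k^-1); apply: lt_le_trans (kZ _).
rewrite lte_fin -ltr_pdivrMl// mulr1.
by apply: le_lt_trans (archi_boundP _) => //; rewrite invr_ge0 ltW.
Qed.

(** Along the integers this is monotone convergence, the integrands being
    eventually constant; monotonicity in [x] makes the limit along the reals
    exist, and so coincide with it. *)
Lemma cvg_expected_disutility n : Z n x%:E @[x --> +oo%R] --> Z n +oo.
Proof.
have Zhomo : nondecreasing_fun (fun x : R => Z n x%:E).
  move=> x y xy; apply: ge0_le_integral => //.
  - by move=> w _; rewrite lee_fin disutility_ge0.
  - move=> w _; rewrite lee_fin ler_expR ler_pM2l// lerB// lerB//.
    have /andP[l0 _] := compensation_bounds.
    by rewrite ler_wpM2l//= !maxEle; do 2 case: ifPn => ?; lra.
have cvgZ := nondecreasing_cvge Zhomo.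
suff -> : Z n +oo = ereal_sup (range (fun x : R => Z n x%:E)) by [].
have /cvge_pinftyP/(_ (fun j => j%:R)) := cvgZ.
move=> /(_ (cvgr_idn))/cvg_lim <-//.
apply/esym/cvg_lim => //.
have lim_disutility w : (disutility m j%:R%:E (X n w))%:E @[j --> \oo] -->
    (disutility m +oo (X n w))%:E.
  apply: cvg_near_cst; near=> j; rewrite /disutility.
  suff -> : overrun (X n w) j%:R%:E = 0%R by [].
  rewrite /overrun; apply/max_idPr; rewrite subr_le0.
  by near: j; exact: nbhs_infty_ger.
rewrite [X in _ --> X](_ : _ =
    \int[P]_w (limn (fun j => (disutility m j%:R%:E (X n w))%:E))); last first.
  by apply: eq_integral => w _; exact/esym/cvg_lim.
apply: cvg_monotone_convergence => //.
- by move=> j w _; rewrite lee_fin disutility_ge0.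
- by move=> w _ i j ij; rewrite lee_fin le_disutility ?lee_fin ?ler_nat.
Unshelve. all: by end_near. Qed.

Lemma lim_joining_utility n :
  lim (joining_utility m X n x%:E @[x --> +oo%R]) = joining_utility m X n +oo.
Proof.
apply/cvg_lim => //; rewrite joining_utilityE.
under eq_fun do rewrite joining_utilityE.
apply: cvgeZl => //; apply: cvgeB; [by []|exact: cvg_cst|].
exact: cvg_expected_disutility.
Qed.

End model.
End expected_disutility.

(** * Balking thresholds *)

Lemma nat_minP (A : set nat) : A !=set0 ->
  A (nat_min A) /\ forall k, A k -> (nat_min A <= k)%N.
Proof.
move=> [a Aa].
have ex : exists n, `[< A n >] by exists a; exact/asboolP.
rewrite /nat_min; case: xgetP => [n _ //|/(_ (ex_minn ex))[]].
by case: ex_minnP => n /asboolP An nmin; split=> // k Ak; exact/nmin/asboolP.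
Qed.

(** Passage to the limit [e -> 0]. *)
Lemma le_of_expR_le {R : realType} (a y z : R) : 0 <= a -> 0 < y ->
  (forall e, 0 < e -> z <= expR (a * e) * y) -> z <= y.
Proof.
move=> a0 y0 zy; rewrite leNgt; apply/negP => yz.
(* At [e = ln (z / y) / (a + 1)] the hypothesis would give [z < z]. *)
have z0 := lt_trans y0 yz.
have a1 : 0 < a + 1 by rewrite ltr_wpDl.
have zy0 : 0 < ln (z / y) by rewrite ln_gt0// ltr_pdivlMr// mul1r.
have e0 : 0 < ln (z / y) / (a + 1) by rewrite divr_gt0.
have := zy _ e0; apply/negP; rewrite -ltNge -ltr_pdivlMr//.
rewrite -[ltRHS]lnK ?posrE ?divr_gt0// ltr_expR.
by rewrite mulrCA gtr_pMr// ltr_pdivrMr// mul1r ltrDl.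
Qed.

Section thresholds.
Context {R : realType} {disp : measure_display} {T : measurableType disp}
  {P : probability T R}.
Context (m : params R) (service_gt0 : (0 < service m)%R)
  (risk_gt0 : (0 < risk m)%R)
  (compensation_bounds : (0 <= compensation m < waiting m)%R)
  (X : nat -> {RV P >-> R})
  (X_gamma : forall n, is_gamma (X n) n (service m)).
Implicit Types (n k : nat) (d : \bar R).
Local Open Scope ereal_scope.

Local Notation Z n d := (expected_disutility m X n d).

(** The states where customers join form an initial segment of [nat], because
    [Z] is nondecreasing in [n]. *)
Lemma ltn_threshold n d : 0 <= d -> (n < threshold m X d)%N = (Z n d <= 1).
Proof.
move=> d0.
have [] := @nat_minP [set n | joining_utility m X n d < 0].
  have [k Zk] := expected_disutility_unbounded service_gt0 risk_gt0
    compensation_bounds X_gamma d0.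
  by exists k; rewrite /= joining_utility_lt0.
rewrite -/(threshold m X d) /= joining_utility_lt0// => ZN Nmin.
apply/idP/idP => [|Zn].
  apply: contraTT; rewrite -ltNge -leqNgt => Zn; apply: Nmin.
  by rewrite joining_utility_lt0.
rewrite ltnNge; apply: contraL ZN => Nn; rewrite -leNgt.
apply: le_trans Zn.
exact: (expected_disutility_homo service_gt0 risk_gt0 compensation_bounds
  X_gamma d0 Nn).
Qed.

Lemma threshold_eq k d : 0 <= d ->
  (forall n, (n < k)%N -> Z n d <= 1) -> 1 < Z k d -> threshold m X d = k.
Proof.
move=> d0 lek gtk; apply/eqP; rewrite eqn_leq; apply/andP; split.
  by rewrite leqNgt ltn_threshold// -ltNge.
by rewrite leqNgt; apply/negP => /lek; rewrite -ltn_threshold// ltnn.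
Qed.

Lemma threshold_antitone d d' : 0 <= d -> d <= d' ->
  (threshold m X d' <= threshold m X d)%N.
Proof.
move=> d0 dd'; have d'0 := le_trans d0 dd'.
rewrite leqNgt ltn_threshold// -ltNge.
have : ~~ (threshold m X d < threshold m X d)%N by rewrite ltnn.
rewrite ltn_threshold// -ltNge => /lt_le_trans; apply.
exact: le_expected_disutility.
Qed.

Lemma n_lowerE : n_lower m X = threshold m X +oo.
Proof.
rewrite /n_lower /threshold; congr nat_min; apply/funext => n /=.
by rewrite lim_joining_utility.
Qed.

Lemma threshold_bounds d : 0 <= d ->
  (n_lower m X <= threshold m X d <= n_upper m X)%N.
Proof.
by move=> d0; rewrite n_lowerE !threshold_antitone// leey.
Qed.

(** Continuity of [Z n] at the supremum [s] gives [Z n s <= 1] from the quotes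
    below [s] and [1 <= Z n s] from those above it; then [Z n.+1 s] exceeds 1 by
    the growth in [n]. *)
Lemma max_joining_quoteP n : Z n 0 <= 1 -> 1 < Z n +oo ->
  exists s : R, [/\ max_joining_quote m X n = s%:E, 0 <= s%:E,
    forall d, 0 <= d -> Z n d <= 1 -> d <= s%:E,
    Z n s%:E <= 1 & 1 < Z n.+1 s%:E].
Proof.
move=> Zn0 Zny.
have /andP[l0 lc] := compensation_bounds.
pose D := [set d | 0 <= d /\ Z n d <= 1].
have D0 : D 0 by [].
have supE : max_joining_quote m X n = ereal_sup D.
  have -> : D = [set d | 0 <= d /\ 0 <= joining_utility m X n d].
    by apply/funext => d; rewrite /D /= joining_utility_ge0.
  rewrite /max_joining_quote; case: pselect => // D_eq0; exfalso.
  by move: D_eq0; apply/eqP/set0P; exists 0; split; rewrite ?joining_utility_ge0.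
have [x x0 Zx] : exists2 x : R, (0 <= x)%R & 1 < Z n x%:E.
  apply: contrapT => /forall2NP Zle1; move: Zny; apply/negP; rewrite -leNgt.
  have Zcvg := @cvg_expected_disutility _ _ _ P _ risk_gt0
    compensation_bounds X n.
  apply: (cvge_le _ Zcvg).
  near=> x; rewrite leNgt; apply/negP => Zx.
  by case: (Zle1 x) => // /negP; apply; near: x; exact: nbhs_pinfty_ge.
have D_le d : D d -> d <= x%:E.
  move=> [d0]; apply: contraTT; rewrite -!ltNge => /ltW xd.
  by apply: lt_le_trans Zx _; exact: le_expected_disutility.
have sup_fin : ereal_sup D \is a fin_num.
  rewrite ge0_fin_numE; last exact: ereal_sup_ubound.
  by apply: (@le_lt_trans _ _ x%:E); rewrite ?ltry//; exact: ge_ereal_sup.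
pose s := fine (ereal_sup D).
have sE : ereal_sup D = s%:E by rewrite fineK.
have le_s d : D d -> d <= s%:E by rewrite -sE => Dd; exact: ereal_sup_ubound.
have s0 : (0 <= s)%R by rewrite -lee_fin; exact: le_s.
set a := (risk m * compensation m)%R.
have a0 : (0 <= a)%R by rewrite mulr_ge0// ltW.
have Zs_approx (e : R) : (0 < e)%R -> Z n s%:E <= (expR (a * e) * 1)%:E.
  move=> e0; have : (s - e)%:E < ereal_sup D.
    by rewrite sE lte_fin ltrBlDr ltrDl.
  move=> /ereal_sup_gt[d Dd]; have ds := le_s _ Dd.
  case: d Dd ds => [d [_ Zd]||] //; rewrite lee_fin lte_fin => ds sed.
  apply: le_trans (expected_disutility_Lipschitz risk_gt0 compensation_bounds
    X n ds) _.
  rewrite mulr1 -[leRHS]mule1; apply: lee_pmul; last exact: Zd.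
  - by rewrite lee_fin expR_ge0.
  - exact: expected_disutility_ge0.
  - by rewrite lee_fin ler_expR ler_wpM2l//; lra.
have Zs_fin : Z n s%:E \is a fin_num.
  rewrite ge0_fin_numE ?expected_disutility_ge0//.
  exact: le_lt_trans (Zs_approx _ ltr01) (ltry _).
move: Zs_approx (expected_disutility_ge0 m X n s%:E).
rewrite -(fineK Zs_fin); set z := fine _ => Zs_approx z0.
have z_le1 : (z <= 1)%R.
  by apply: (le_of_expR_le a0 ltr01) => e e0; rewrite -lee_fin; exact: Zs_approx.
have z_approx (e : R) : (0 < e)%R -> (1 <= expR (a * e) * z)%R.
  move=> e0; have ses : (s <= s + e)%R by rewrite lerDl ltW.
  rewrite -lee_fin EFinM /z fineK//.
  have := expected_disutility_Lipschitz risk_gt0 compensation_bounds X n ses.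
  rewrite addrAC subrr add0r; apply: le_trans; apply: ltW.
  rewrite ltNge; apply/negP => Zse.
  have /le_s : D (s + e)%:E by split=> //; rewrite lee_fin addr_ge0// ltW.
  by rewrite lee_fin leNgt ltrDl e0.
have z_gt0 : (0 < z)%R.
  by have := lt_le_trans ltr01 (z_approx _ ltr01); rewrite pmulr_rgt0// expR_gt0.
have z_ge1 : (1 <= z)%R by exact: le_of_expR_le z_approx.
exists s; split.
- by rewrite supE.
- exact: s0.
- by move=> d d0 Zd; apply: le_s; split; [exact: d0|exact: Zd].
- by rewrite -(fineK Zs_fin) lee_fin.
- have := expected_disutilityS service_gt0 risk_gt0 compensation_bounds
    X_gamma n (d := s%:E) s0.
  apply: lt_le_trans; rewrite -(fineK Zs_fin) -EFinD lte_fin -/z.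
  by rewrite ltr_pwDr// divr_gt0// disutility_slope_gt0.
Unshelve. all: by end_near. Qed.

(** A quote [d] with threshold [n0 > 0] is accepted in state [n0 - 1], so it is
    at most the supremum of the quotes accepted there; that this supremum is in
    turn rejected in state [n0] is what [max_joining_quoteP] provides. *)
Lemma candidate_quoteP n0 : (n_lower m X <= n0 <= n_upper m X)%N ->
  [/\ 0 <= candidate_quote m X n0,
      threshold m X (candidate_quote m X n0) = n0 &
      forall d, 0 <= d -> threshold m X d = n0 -> d <= candidate_quote m X n0].
Proof.
move=> /andP[lower_n0 n0_upper]; rewrite /candidate_quote; case: eqP => [->|/eqP].
  by split; rewrite ?leey ?n_lowerE// => d _ _; exact: leey.
move=> n0_neq; have {n0_neq lower_n0} lower_n0 : (n_lower m X < n0)%N.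
  by rewrite ltn_neqAle eq_sym n0_neq.
case: n0 => // n in lower_n0 n0_upper *.
rewrite ltnS n_lowerE leqNgt ltn_threshold// -ltNge in lower_n0.
rewrite [n_upper m X]/(threshold m X 0) ltn_threshold// in n0_upper.
have [s [-> s0 s_max Zs ZSs]] := max_joining_quoteP n0_upper lower_n0.
split; first exact: s0.
- apply: threshold_eq; [exact: s0| |exact: ZSs].
  move=> k; rewrite ltnS => kn; apply: le_trans Zs.
  exact: (expected_disutility_homo service_gt0 risk_gt0 compensation_bounds
    X_gamma s0 kn).
- move=> d d0 dn; apply: s_max; first exact: d0.
  by rewrite -ltn_threshold ?dn.
Qed.

(** * Optimal profit *)

Lemma lateness_antitone n d d' : 0 <= d -> d <= d' ->
  lateness X n d' <= lateness X n d.
Proof.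
have mover d1 : measurable_fun setT (fun w => (overrun (X n w) d1)%:E).
  apply/measurable_EFinP; apply: (measurableT_comp (f := fun x => overrun x d1)).
    exact: measurable_overrun.
  exact: measurable_funPT.
move=> d0 dd'; rewrite /lateness unlock; apply: ge0_le_integral => //.
- by move=> w _; rewrite lee_fin overrun_ge0.
- by move=> w _; rewrite lee_fin overrun_antitone.
Qed.

Lemma le_profit d d' : (0 < arrival m)%R -> 0 <= d -> d <= d' ->
  threshold m X d = threshold m X d' -> profit m X d <= profit m X d'.
Proof.
have /andP[l0 _] := compensation_bounds.
move=> arrival_gt0 d0 dd' dd'_eq; have d'0 := le_trans d0 dd'.
rewrite /profit dd'_eq lee_pmul2l//.
rewrite big_nat [leRHS]big_nat; apply: lee_sum => n /andP[_ n_lt].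
rewrite lee_wpmul2l//.
  rewrite lee_fin /state_prob divr_ge0//; last apply: sumr_ge0 => k _;
    by rewrite exprn_ge0// divr_ge0// ltW.
rewrite /gain !joining_utility_ge0//.
rewrite -!ltn_threshold// dd'_eq n_lt leeB// lee_wpmul2l//.
exact: lateness_antitone.
Qed.

Lemma best_profitE n0 : (0 < arrival m)%R ->
  (n_lower m X <= n0 <= n_upper m X)%N ->
  best_profit m X n0 = profit m X (candidate_quote m X n0).
Proof.
move=> arrival_gt0 /candidate_quoteP[c0 thc c_max].
apply/eqP; rewrite eq_le; apply/andP; split; last first.
  by apply: ereal_sup_ubound; exists (candidate_quote m X n0).
apply: ge_ereal_sup => _ [d [d0 thd] <-]; apply: le_profit => //.
  exact: c_max.
by rewrite thd thc.
Qed.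

Lemma exists_best_threshold : exists n0, is_best_threshold m X n0.
Proof.
have lower_upper : (n_lower m X <= n_upper m X)%N.
  by rewrite n_lowerE; exact: threshold_antitone.
pose inrange := fun i : 'I_(n_upper m X).+1 => (n_lower m X <= i)%N.
case: (@Order.TotalTheory.arg_maxP _ _ _ (ord_max : 'I_(n_upper m X).+1)
  inrange (fun i => best_profit m X i) lower_upper) => i lower_i i_max.
exists i; split=> [|k /andP[lower_k k_upper]].
  by rewrite [(n_lower m X <= i)%N]lower_i -ltnS ltn_ord.
rewrite -ltnS in k_upper.
exact: (i_max (Ordinal k_upper)).
Qed.

End thresholds.

Theorem theorem2 (R : realType) (m : params R)
    (arrival_gt0 : 0 < arrival m) (service_gt0 : 0 < service m)
    (waiting_gt0 : 0 < waiting m) (risk_gt0 : 0 < risk m)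
    (fee_bounds : 0 <= fee m <= value m)
    (compensation_bounds : 0 <= compensation m < waiting m)
    (disp : measure_display) (T : measurableType disp) (P : probability T R)
    (X : nat -> {RV P >-> R})
    (X_gamma : forall n : nat, is_gamma (X n) n (service m)) :
  (exists nP : nat, is_best_threshold m X nP) /\
  forall nP : nat, is_best_threshold m X nP ->
    let dP := candidate_quote m X nP in
    [/\ (0 <= dP)%E,
        threshold m X dP = nP,
        forall d : \bar R, (0 <= d)%E -> (profit m X d <= profit m X dP)%E,
        profit m X dP = ereal_sup [set profit m X d | d in [set d : \bar R | (0 <= d)%E]]
      & ereal_sup [set profit m X d | d in [set d : \bar R | (0 <= d)%E]] =
        ((arrival m)%:E *
         \sum_(0 <= n < nP) (state_prob m n nP)%:E * gain m X n dP)%E].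
Proof.
split=> [|nP [nP_range nP_best] dP].
  exact: (exists_best_threshold service_gt0 risk_gt0 compensation_bounds X_gamma).
have [dP0 dP_threshold dP_max] := candidate_quoteP service_gt0 risk_gt0
  compensation_bounds X_gamma nP_range.
have profit_le d : (0 <= d)%E -> (profit m X d <= profit m X dP)%E.
  move=> d0.
  have d_range := threshold_bounds service_gt0 risk_gt0 compensation_bounds
    X_gamma d0.
  have := nP_best _ d_range.
  rewrite (best_profitE service_gt0 risk_gt0 compensation_bounds X_gamma
    arrival_gt0 nP_range).
  by apply: le_trans; apply: ereal_sup_ubound; exists d.
have supE : profit m X dP =
    ereal_sup [set profit m X d | d in [set d : \bar R | (0 <= d)%E]].
  apply/eqP; rewrite eq_le; apply/andP; split.
    by apply: ereal_sup_ubound; exists dP.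
  by apply: ge_ereal_sup => _ [d d0 <-]; exact: profit_le.
by split=> //; rewrite -supE /profit dP_threshold.
Qed.
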